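(* $\mathfrak{Z}(\mathcal{S})$ is a (nonzero) limit ordinal.
   Context: An LMP is a triple $\mathbb{S}=(S,\Sigma,\{\tau_a\mid a\in L\})$ with $(S,\Sigma)$ a measurable space, $L$ a countable label set, and each $\tau_a:S\times\Sigma\to[0,1]$ a Markov kernel (subprobability measure in the second argument, measurable in the first). It is separable if $\Sigma$ is countably generated and separates points of $S$. For $R\subseteq S\times S$, $\Sigma(R)$ is the family of $R$-closed sets in $\Sigma$ ($A$ is $R$-closed if $x\in A$, $xRs$ imply $s\in A$). $\mathcal{R}(\Gamma)=\{(s,t):\forall A\in\Gamma\,(s\in A\iff t\in A)\}$; $\mathcal{R}^T(\Lambda)=\{(s,t):\forall a\,\forall E\in\Lambda\ \tau_a(s,E)=\tau_a(t,E)\}$; $\mathcal{O}(R)=\mathcal{R}^T(\Sigma(R))$, with iterates $\mathcal{O}^0(R)=R$, $\mathcal{O}^{\alpha+1}(R)=\mathcal{O}(\mathcal{O}^\alpha(R))$, $\mathcal{O}^\lambda(R)=\bigcap_{\alpha<\lambda}\mathcal{O}^\alpha(R)$ for limit $\lambda$. Event bisimilarity ${\sim_e}=\mathcal{R}(\sigma(\llbracket\mathcal{L}\rrbracket))$, where $\sigma(\llbracket\mathcal{L}\rrbracket)$ is the $\sigma$-algebra generated by the denotations of formulas $\phi::=\top\mid\phi\wedge\psi\mid\langle a\rangle_{>q}\phi$ ($q\in\mathbb{Q}\cap[0,1]$), $\llbracket\langle a\rangle_{>q}\phi\rrbracket=\{s:\tau_a(s,\llbracket\phi\rrbracket)>q\}$.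 A state bisimulation is a symmetric $R$ with $sRt$, $C\in\Sigma(R)$ implying $\tau_a(s,C)=\tau_a(t,C)$ for all $a$; state bisimilarity $\sim_s$ is the union of all state bisimulations. The Zhou ordinal $\mathfrak{Z}(\mathbb{S})$ is the least $\alpha$ with $\mathcal{O}^\alpha(\sim_e)={\sim_s}$ (it exists). $\mathfrak{Z}(\mathcal{S})$ is the supremum of $\mathfrak{Z}(\mathbb{S})$ over all separable LMPs $\mathbb{S}$ (this is bounded). *)

(* Defs.v *)
From HB Require Import structures.
From mathcomp Require Import all_boot all_order all_algebra.
From mathcomp Require Import all_classical all_reals all_analysis.
Set Implicit Arguments. Unset Strict Implicit. Unset Printing Implicit Defensive.
Import Order.TTheory GRing.Theory Num.Theory.
Local Open Scope classical_set_scope.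
Local Open Scope ring_scope.

(* A Markov kernel (subprobability measure in the second argument,     *)
(* measurable in the first) is MathComp-Analysis' R.-spker T ~> T.     *)
Record LMP (R : realType) (L : Type) := MkLMP {
  lmp_d : measure_display;
  lmp_T : measurableType lmp_d;
  lmp_tau : L -> R.-spker lmp_T ~> lmp_T }.

Arguments lmp_tau {R L} S a : rename.

Definition Rel (T : Type) := T -> T -> Prop.

Section LMPdefs.
Context (R : realType) (L : Type) (S : LMP R L).
Local Notation T := (lmp_T S).
Local Notation tau := (lmp_tau S).

Definition separable : Prop :=
  (exists G : nat -> set T, @measurable _ T = <<s range G >>) /\
  (forall x y : T, x <> y -> exists A : set T, measurable A /\ A x /\ ~ A y).

Definition Rclosed (Q : Rel T) (A : set T) : Prop :=
  forall x s, A x -> Q x s -> A s.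

Definition SigmaR (Q : Rel T) : set (set T) :=
  [set A | measurable A /\ Rclosed Q A].

Definition RR (Gamma : set (set T)) : Rel T :=
  fun s t => forall A, Gamma A -> (A s <-> A t).

Definition RT (Lambda : set (set T)) : Rel T :=
  fun s t => forall (a : L) (E : set T), Lambda E -> tau a s E = tau a t E.

Definition Oop (Q : Rel T) : Rel T := RT (SigmaR Q).

Inductive formula :=
  | FTop
  | FAnd of formula & formula
  | FDiam of L & rat & formula.

Fixpoint wf_formula (f : formula) : Prop :=
  match f with
  | FTop => True
  | FAnd f g => wf_formula f /\ wf_formula g
  | FDiam _ q f => (0 <= q <= 1)%R /\ wf_formula f
  end.

Fixpoint den (f : formula) : set T :=
  match f with
  | FTop => setT
  | FAnd f g => den f `&` den g
  | FDiam a q f => [set s | ((ratr q)%:E < tau a s (den f))%E]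
  end.

Definition formula_sets : set (set T) :=
  [set X | exists f, wf_formula f /\ X = den f].

Definition sim_e : Rel T := RR (<<s formula_sets >>).

Definition state_bisim (Q : Rel T) : Prop :=
  (forall s t, Q s t -> Q t s) /\
  (forall s t, Q s t -> forall C, SigmaR Q C -> forall a, tau a s C = tau a t C).

Definition sim_s : Rel T := fun s t => exists Q, state_bisim Q /\ Q s t.

End LMPdefs.

Arguments separable {R L} S.
Arguments Oop {R L} S Q _ _.
Arguments sim_e {R L} S _ _.
Arguments sim_s {R L} S _ _.

(* Ordinals, represented as elements of well-ordered types.           *)
Record woType := MkWo {
  wo_car :> Type;
  wo_lt : wo_car -> wo_car -> Prop;
  wo_wf : well_founded wo_lt;
  wo_trans : forall x y z, wo_lt x y -> wo_lt y z -> wo_lt x z;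
  wo_total : forall x y, wo_lt x y \/ x = y \/ wo_lt y x }.

Arguments wo_lt {W} x y : rename.

Section Iterates.
Context (W : woType) (T : Type) (O : Rel T -> Rel T) (R0 : Rel T).

Definition is_pred (w p : W) : Prop :=
  wo_lt p w /\ forall v, wo_lt v w -> v = p \/ wo_lt v p.

Definition iter_step (w : W) (rec : forall v : W, wo_lt v w -> Rel T) : Rel T :=
  match pselect (exists p, is_pred w p) with
  | left hp => let (p, Hp) := cid hp in O (rec p (proj1 Hp))
  | right _ =>
      match pselect (exists v, wo_lt v w) with
      | left _ => fun s t => forall v (h : wo_lt v w), rec v h s t
      | right _ => R0
      end
  end.

Definition Oiter : W -> Rel T := Fix (@wo_wf W) (fun _ => Rel T) iter_step.

End Iterates.

Definition wo_le (W : woType) (u w : W) : Prop := u = w \/ wo_lt u w.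

Definition nonzero_limit (W : woType) (w : W) : Prop :=
  (exists v, wo_lt v w) /\
  (forall v, wo_lt v w -> exists u, wo_lt v u /\ wo_lt u w).

(* Zhou(S) <= (ordinal of w): the least alpha with O^alpha(sim_e) = sim_s
   is at most w. *)
Definition zhou_le (R : realType) (L : Type) (S : LMP R L) (W : woType) (w : W)
  : Prop :=
  exists u : W, wo_le u w /\
    forall s t, Oiter (Oop S) (sim_e S) u s t <-> sim_s S s t.

(* Zhou(class of separable LMPs) = (ordinal of w): the supremum. *)
Definition zhou_class_is (R : realType) (L : Type) (W : woType) (w : W) : Prop :=
  (forall S : LMP R L, separable S -> zhou_le S w) /\
  (forall v : W, wo_lt v w ->
     exists S : LMP R L, separable S /\ ~ zhou_le S v).

(* Main.v *)
Require Import Defs.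
From HB Require Import structures.
From mathcomp Require Import all_boot all_order all_algebra.
From mathcomp Require Import all_classical all_reals all_analysis.
From mathcomp Require Import wochoice measurable_realfun ring.
Set Implicit Arguments. Unset Strict Implicit. Unset Printing Implicit Defensive.
Import Order.TTheory GRing.Theory Num.Theory numFieldNormedType.Exports.
Local Open Scope classical_set_scope.
Local Open Scope ring_scope.

(** A separable LMP has at most continuum many states, and the iterates of [O]
    strictly decrease until they reach state bisimilarity; hence all Zhou ordinals
    are attained inside one well-ordered type [W] that does not inject into the
    relations on any such state space, and the supremum [w] is the least upper
    bound in [W].

    No Zhou ordinal is the largest: if [(s, t)] lies in [O^v] but not in state
    bisimilarity, add two states [p] and [q] jumping surely to [s] and to [t].
    Then [(p, q)] lies in [O^(v+1)], and [p], [q] are not bisimilar since some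
    measurable bisimilarity-closed set separates [s] from [t].

    The supremum is not zero: let [V] be a Vitali set.  On the intersection [D] of
    measurable hulls of [V] and of its complement in [0, 1], the traces of Lebesgue
    outer measure on [V] and on its complement agree on Borel sets but not on [V].
    Take the reals with the sigma-algebra generated by the Borel sets and [V], let
    [x] move with total mass [sigmoid x], so that the logic sees only Borel
    sets, and add two states moving according to the two traces. *)

(** * Transfinite iteration *)

Section OrdinalIteration.
Context (W : woType) (T : Type) (O : Rel T -> Rel T) (R0 : Rel T).
Local Notation I := (Oiter (W := W) O R0).

Lemma wo_lt_irr (x : W) : ~ wo_lt x x.
Proof. by elim/(well_founded_ind (@wo_wf W)): x => x IH xx; exact: (IH x). Qed.

Lemma wo_ltNge (u v : W) : ~ wo_lt u v <-> v = u \/ wo_lt v u.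
Proof.
split; first by have [|[->|]] := wo_total u v; auto.
by move=> [->|vu uv]; [exact: wo_lt_irr|exact: wo_lt_irr (wo_trans vu uv)].
Qed.

Lemma wo_min (P : W -> Prop) :
  (exists w, P w) -> exists w, P w /\ forall v, wo_lt v w -> ~ P v.
Proof.
case=> w; elim/(well_founded_ind (@wo_wf W)): w => w IH Pw.
have [[v vw Pv]|nP] := pselect (exists2 v, wo_lt v w & P v); first exact: IH Pv.
by exists w; split=> // v vw Pv; apply: nP; exists v.
Qed.

Lemma wo_succ (v w : W) : wo_lt v w -> exists v', is_pred v' v.
Proof.
move=> vw; have [|v' [vv' min]] := @wo_min (fun x => wo_lt v x); first by exists w.
by exists v'; split=> // u /min /wo_ltNge.
Qed.

Lemma is_pred_inj (w p q : W) : is_pred w p -> is_pred w q -> p = q.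
Proof.
move=> [pw hp] [qw hq]; have [//|qp] := hq _ pw; have [//|pq] := hp _ qw.
by case: (wo_lt_irr (wo_trans pq qp)).
Qed.

Lemma OiterE (w : W) : I w = iter_step O R0 (fun v (_ : wo_lt v w) => I v).
Proof.
rewrite /Oiter Fix_eq // => x f g fg.
by congr iter_step; apply: functional_extensionality_dep => v; apply/funext => h.
Qed.

Lemma Oiter_zero (w : W) : (forall v, ~ wo_lt v w) -> I w = R0.
Proof.
move=> w0; rewrite OiterE /iter_step; case: pselect => [[p [/w0]]//|_].
by case: pselect => [[p /w0]|].
Qed.

Lemma Oiter_succ (w p : W) : is_pred w p -> I w = O (I p).
Proof.
move=> wp; rewrite OiterE /iter_step; case: pselect => [hp|[]]; last by exists p.
by case: cid => q wq; rewrite (is_pred_inj wq wp).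
Qed.

Lemma Oiter_limit (w : W) : (exists v, wo_lt v w) ->
  ~ (exists p, is_pred w p) ->
  I w = fun s t => forall v, wo_lt v w -> I v s t.
Proof.
by move=> ? ?; rewrite OiterE /iter_step; case: pselect => // _; case: pselect.
Qed.

(** [P] takes the iterate as a second argument, so each case receives it already unfolded. *)
Lemma Oiter_ind (P : W -> Rel T -> Prop) :
  (forall w, (forall v, ~ wo_lt v w) -> P w R0) ->
  (forall w p, is_pred w p -> P p (I p) -> P w (O (I p))) ->
  (forall w, (exists v, wo_lt v w) -> ~ (exists p, is_pred w p) ->
     (forall v, wo_lt v w -> P v (I v)) ->
     P w (fun s t => forall v, wo_lt v w -> I v s t)) ->
  forall w, P w (I w).
Proof.
move=> P0 PS PL w; elim/(well_founded_ind (@wo_wf W)): w => w IH.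
have [[p wp]|np] := pselect (exists p, is_pred w p).
  by rewrite (Oiter_succ wp); apply: PS => //; apply: IH; case: wp.
have [ev|nv] := pselect (exists v, wo_lt v w).
  by rewrite Oiter_limit //; exact: PL.
have w0 v : ~ wo_lt v w by move=> vw; apply: nv; exists v.
by rewrite Oiter_zero //; exact: P0.
Qed.

Hypothesis O_mono : forall Q Q' : Rel T,
  (forall s t, Q s t -> Q' s t) -> forall s t, O Q s t -> O Q' s t.
Hypothesis O_R0 : forall s t, O R0 s t -> R0 s t.

Lemma Oiter_shrink (w : W) s t : O (I w) s t -> I w s t.
Proof.
move: w s t; apply: (@Oiter_ind (fun _ X => forall s t, O X s t -> X s t)) => //
  [w p _ IH|w _ _ IH s t h v vw].
  exact: O_mono.
by apply: IH => //; apply: O_mono h => x y; apply.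
Qed.

(** Sharper than antitonicity: a later stage lies below one further application of [O]. This is what
    makes an iteration with two equal values stationary. *)
Lemma Oiter_lt (u v : W) s t : wo_lt u v -> I v s t -> O (I u) s t.
Proof.
move=> uv h; move: v uv s t h.
apply: (@Oiter_ind (fun v X => wo_lt u v -> forall s t, X s t -> O (I u) s t)).
- by move=> w w0 /w0.
- move=> w p [_ hp] IH /hp[->//|up] s t; apply: O_mono => x y /(IH up).
  exact: Oiter_shrink.
- move=> w _ np IH uw s t h.
  (* Otherwise [u] would be the predecessor of the limit [w]. *)
  have [u' u'w uu'] : exists2 u', wo_lt u' w & wo_lt u u'.
    apply: contrapT => nu; apply: np; exists u; split=> // v vw.
    by apply/wo_ltNge => uv; apply: nu; exists v.
  by apply: (IH u') => //; exact: h.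
Qed.

Lemma Oiter_le (u v : W) s t : wo_le u v -> I v s t -> I u s t.
Proof. by move=> [->//|uv] /(Oiter_lt uv); exact: Oiter_shrink. Qed.

Lemma sub_Oiter (Q : Rel T) : (forall s t, Q s t -> R0 s t) ->
  (forall s t, Q s t -> O Q s t) -> forall (w : W) s t, Q s t -> I w s t.
Proof.
move=> Q0 QO w; apply: (@Oiter_ind (fun _ X => forall s t, Q s t -> X s t)) => //.
- by move=> {}w p _ IH s t /QO; exact: O_mono.
- by move=> {}w _ _ IH s t Qst v vw; exact: IH.
Qed.

End OrdinalIteration.

(** * Event and state bisimilarity as bounds of the iterates *)

Lemma sigma_algebra_iff (T : Type) (G : set (set T)) (s t : T) :
  (forall A, G A -> (A s <-> A t)) -> forall A, <<s G >> A -> (A s <-> A t).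
Proof.
(* The sets that do not separate [s] from [t] form a sigma-algebra. *)
move=> hG A; apply: (@smallest_sub _ _ _ [set A | A s <-> A t]) => //=.
split=> [|B [st ts]|F hF]; first by [].
- by split=> -[_ nB]; split=> // /[dup] ?; [move/ts|move/st].
- by split=> -[i _ Fi]; exists i => //; apply/hF.
Qed.

Section StateBisimilarity.
Context (R : realType) (L : Type) (S : LMP R L).
Local Notation T := (lmp_T S).
Local Notation tau := (lmp_tau S).
Implicit Types (Q : Rel T) (s t : T).

Lemma Oop_mono Q Q' : (forall s t, Q s t -> Q' s t) ->
  forall s t, Oop S Q s t -> Oop S Q' s t.
Proof.
move=> QQ' s t h a E [mE cE]; apply: h; split=> // x y Ex Qxy.
exact/(cE _ _ Ex)/QQ'.
Qed.

Lemma measurable_tau_gt a (E : set T) (r : \bar R) :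
  measurable E -> measurable [set s | (r < tau a s E)%E].
Proof.
move=> mE; have := measurable_kernel (tau a) _ mE.
by move=> /(_ measurableT _ (emeasurable_itv `]r, +oo[)); rewrite setTI set_itvoy.
Qed.

Lemma measurable_den f : measurable (den (S := S) f).
Proof.
elim: f => [|f mf g mg|a q f mf] /=; first exact: measurableT.
- exact: measurableI.
- exact: measurable_tau_gt.
Qed.

Lemma sim_e_formula s t : (forall f, wf_formula f -> den f s <-> den f t) ->
  sim_e S s t.
Proof.
by move=> h; apply: sigma_algebra_iff => _ [f [wf ->]]; exact: h.
Qed.

Lemma sim_e_den s t f : wf_formula f -> sim_e S s t -> den f s <-> den f t.
Proof. by move=> wf; apply; apply: sub_sigma_algebra; exists f. Qed.

(** Denotations are measurable and closed under [sim_e], so equal kernel values on closed sets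
    preserve the truth of diamonds. *)
Lemma Oop_sim_e s t : Oop S (sim_e S) s t -> sim_e S s t.
Proof.
move=> h; apply: sim_e_formula; elim=> [|f IHf g IHg|a q f IHf] //=.
  by move=> [/IHf[? ?] /IHg[? ?]]; split=> -[]; auto.
move=> [_ wf]; rewrite (h a (den f)) //; split; first exact: measurable_den.
by move=> x y fx /(sim_e_den wf)[]; auto.
Qed.

Lemma sim_s_sym s t : sim_s S s t -> sim_s S t s.
Proof. by move=> [Q [[sQ hQ] Qst]]; exists Q; split=> //; exact: sQ. Qed.

Lemma sim_s_Oop s t : sim_s S s t -> Oop S (sim_s S) s t.
Proof.
move=> [Q [bQ Qst]] a E [mE cE]; apply: (bQ.2 _ _ Qst); split=> // x y Ex Qxy.
by apply: cE Ex _; exists Q.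
Qed.

Lemma bisim_sub_sim_s Q : (forall s t, Q s t -> Q t s) ->
  (forall s t, Q s t -> Oop S Q s t) -> forall s t, Q s t -> sim_s S s t.
Proof.
by move=> sQ hQ s t Qst; exists Q; do 2 split=> //; move=> x y /hQ h C ? a; exact: h.
Qed.

(** A fixed point of [Oop] is symmetric, as equality of kernel values is, and hence a state
    bisimulation. *)
Lemma Oop_sub_sim_s Q : (forall s t, Q s t <-> Oop S Q s t) ->
  forall s t, Q s t -> sim_s S s t.
Proof.
move=> QO; apply: bisim_sub_sim_s => s t /QO // h.
by apply/QO => a E SE; rewrite h.
Qed.

(** The Knaster-Tarski argument: by monotonicity [Oop] of bisimilarity is again a postfixed
    point. *)
Lemma Oop_sim_s s t : Oop S (sim_s S) s t -> sim_s S s t.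
Proof.
move: s t; apply: bisim_sub_sim_s => s t h; first by move=> a E SE; rewrite h.
by apply: Oop_mono h; exact: sim_s_Oop.
Qed.

Lemma sim_s_trans s t u : sim_s S s t -> sim_s S t u -> sim_s S s u.
Proof.
move=> /sim_s_Oop st /sim_s_Oop tu; apply: Oop_sim_s => a E SE.
by rewrite st // tu.
Qed.

Lemma sim_s_sim_e s t : sim_s S s t -> sim_e S s t.
Proof.
move=> st; apply: sim_e_formula => f _; elim: f s t st => [|f IHf g IHg|a q f IHf] //=.
  by move=> s t st; rewrite (IHf s t st) (IHg s t st).
move=> s t /sim_s_Oop h; rewrite (h a (den f)) //; split; first exact: measurable_den.
by move=> x y fx /IHf[]; auto.
Qed.

(* The witness set is a superlevel set of [tau a ^~ E]. *)
Lemma sim_s_separated s t : ~ sim_s S s t ->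
  exists2 C, SigmaR (sim_s S) C & ~ (C s <-> C t).
Proof.
move=> nst; apply: contrapT => nC; apply/nst/Oop_sim_s => a E SE.
have SC r : SigmaR (sim_s S) [set x | (r < tau a x E)%E].
  split; first exact: measurable_tau_gt SE.1.
  by move=> x y /= rx /sim_s_Oop xy; rewrite -xy.
apply/eqP; case: ltgtP => // st; exfalso; apply: nC.
- by exists [set x | (tau a s E < tau a x E)%E] => //= -[_ /(_ st)]; rewrite ltxx.
- by exists [set x | (tau a t E < tau a x E)%E] => //= -[/(_ st)]; rewrite ltxx.
Qed.

Section Iterates.
Context (W : woType).
Local Notation I := (Oiter (W := W) (Oop S) (sim_e S)).

Lemma sim_s_Oiter (w : W) s t : sim_s S s t -> I w s t.
Proof. exact: sub_Oiter Oop_mono _ sim_s_sim_e sim_s_Oop w s t. Qed.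

(** [I v] lies below [Oop S (I u)], which lies below [I u]; equality makes [I u] a fixed point. *)
Lemma Oiter_stable (u v : W) : wo_lt u v -> I u = I v ->
  forall s t, I u s t <-> sim_s S s t.
Proof.
move=> uv Iuv s t; split; last exact: sim_s_Oiter.
apply: Oop_sub_sim_s => {}s {}t; split.
  by rewrite {1}Iuv; exact: Oiter_lt Oop_mono Oop_sim_e _ _ _ _ uv.
exact: Oiter_shrink Oop_mono Oop_sim_e _ _ _.
Qed.

(** The form in which lower bounds on Zhou ordinals are proved; antitonicity excludes an earlier
    stabilisation. *)
Lemma zhou_leNP (w : W) :
  ~ zhou_le S w <-> exists s t, I w s t /\ ~ sim_s S s t.
Proof.
split=> [nz|[s [t [Iw nst]]] [u [uw hu]]].
  apply: contrapT => h; apply: nz; exists w; split; first by left.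
  move=> s t; split; last exact: sim_s_Oiter.
  by move=> Iw; apply: contrapT => nst; apply: h; exists s, t.
by apply/nst/hu; exact: Oiter_le Oop_mono Oop_sim_e _ _ _ _ uw Iw.
Qed.

(** Without a stable stage the iterates would be pairwise distinct and inject [W] into the
    relations. *)
Lemma zhou_exists : (~ exists f : W -> Rel T, injective f) ->
  exists w : W, forall s t, I w s t <-> sim_s S s t.
Proof.
move=> nf; apply: contrapT => nw; apply: nf; exists I => u v Iuv.
have [uv|[//|vu]] := wo_total u v; exfalso; apply: nw.
- by exists u; exact: Oiter_stable uv Iuv.
- by exists v; exact: Oiter_stable vu (esym Iuv).
Qed.

End Iterates.

(** A point is determined by the generators that contain it. *)
Lemma separable_card : separable S -> exists f : T -> set nat, injective f.
Proof.
move=> [[G mG] sep]; exists (fun x => [set n | G n x]) => x y xy.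
apply: contrapT => /sep[A [mA [Ax nAy]]]; apply: nAy.
suff : A x <-> A y by case=> + _; apply.
move: mA; rewrite mG; apply: sigma_algebra_iff => _ [n _ <-].
have : [set n | G n x] n = [set n | G n y] n by rewrite xy.
by move=> /= ->.
Qed.

End StateBisimilarity.

(** * Cardinality bound and well-orders *)

Lemma cantor_set (X : Type) (f : set X -> X) : ~ injective f.
Proof.
move=> fi; pose D := [set x | exists2 A, f A = x & ~ A x].
have nD : ~ D (f D) by move=> /[dup] DfD [A /fi ->].
by apply: (nD); exists D.
Qed.

(** Relations on a separable state space inject into [set (set nat * set nat)]; by Cantor, one more
    power set exceeds them all. *)
Definition separable_bound := set (set (set nat * set nat)).

Lemma separable_bound_card (R : realType) (L : Type) (S : LMP R L) :
  separable S -> ~ exists f : separable_bound -> Rel (lmp_T S), injective f.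
Proof.
move=> /separable_card[g gi] [f fi].
pose h (Q : Rel (lmp_T S)) : set (set nat * set nat) :=
  [set p | exists s t, Q s t /\ p = (g s, g t)].
apply: (@cantor_set _ (h \o f)) => A B /= hAB; apply: fi.
suff hi : injective h by exact: hi.
move=> Q Q' hQ; apply/funext => s; apply/funext => t; apply/propext.
have e : h Q (g s, g t) = h Q' (g s, g t) by rewrite hQ.
by split=> Qst; [have : h Q' (g s, g t) by rewrite -e; exists s, t
   |have : h Q (g s, g t) by rewrite e; exists s, t];
   move=> [s' [t' [? [/gi -> /gi ->]]]].
Qed.

Lemma well_order_wo (X : Type) : exists W : woType, wo_car W = X.
Proof.
have [r wo] := well_ordering_principle {classic X}.
(* The order axioms come from least elements of sets of two or three points. *)
have rtot : total r.
  move=> x y; have [z [[]]] : exists! z, minimum_of r (pred2 x y) z.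
    by apply: wo; exists x; rewrite !inE eqxx.
  by rewrite !inE => /orP[] /eqP -> lb _; [rewrite lb|rewrite (lb x) ?orbT] => //;
     rewrite !inE eqxx ?orbT.
have rmin (A : {pred {classic X}}) : nonempty A -> exists2 z, z \in A & lower_bound r A z.
  by move=> /wo[z [[Az lb] _]]; exists z.
have ranti : antisymmetric r.
  move=> x y /andP[xy yx]; have [|z [_ uz]] := wo (pred2 x y).
    by exists x; rewrite !inE eqxx.
  have rr u : r u u by have /orP[] := rtot u u.
  by rewrite -(uz x) ?(uz y) //; split; rewrite ?inE ?eqxx ?orbT // => u;
     rewrite !inE => /orP[] /eqP ->.
have rtrans : transitive r.
  move=> y x z xy yz; have [|m] := rmin (pred3 x y z).
    by exists x; rewrite !inE eqxx.
  rewrite !inE => /or3P[] /eqP -> lb.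
  - by apply: lb; rewrite !inE eqxx !orbT.
  - have yx : r y x by apply: lb; rewrite !inE eqxx.
    by have -> : x = y by apply: ranti; rewrite xy yx.
  - have zy : r z y by apply: lb; rewrite !inE eqxx ?orbT.
    by have <- : y = z by apply: ranti; rewrite zy yz.
pose lt (x y : X) : Prop := ~~ r y x.
have ltwf : well_founded lt.
  move=> x; apply: contrapT => nx.
  have [|z nz lb] := rmin [pred y : {classic X} | `[< ~ Acc lt y >]].
    by exists x; apply/asboolP.
  move: nz => /asboolP; apply; constructor => y ltyz; apply: contrapT => ny.
  by move: ltyz; rewrite /lt lb //; apply/asboolP.
have lttrans x y z : lt x y -> lt y z -> lt x z.
  rewrite /lt => nyx nzy; apply/negP => zx; move/negP: nzy; apply.
  apply: rtrans zx _.
  by have /orP[//|yx] := rtot x y; rewrite yx in nyx.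
have lttot x y : lt x y \/ x = y \/ lt y x.
  rewrite /lt; have [yx|] := boolP (r y x); last by left.
  have [xy|] := boolP (r x y); last by right; right.
  by right; left; apply: ranti; rewrite xy yx.
by exists (MkWo ltwf lttrans lttot).
Qed.

(** * The supremum is a nonzero limit *)

Section AddTop.
Context (W : woType).

Definition top_lt (x y : option W) : Prop :=
  match x, y with
  | Some x, Some y => wo_lt x y
  | Some _, None => True
  | None, _ => False
  end.

Lemma top_wf : well_founded top_lt.
Proof.
have accS x : Acc top_lt (Some x).
  elim/(well_founded_ind (@wo_wf W)): x => x IH.
  by constructor=> -[y|//]; exact: IH.
by case=> [x|]; [exact: accS|constructor=> -[y _|[]]; exact: accS].
Qed.

Lemma top_trans x y z : top_lt x y -> top_lt y z -> top_lt x z.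
Proof. by case: x y z => [x|] [y|] [z|] //=; exact: wo_trans. Qed.

Lemma top_total x y : top_lt x y \/ x = y \/ top_lt y x.
Proof.
case: x y => [x|] [y|] /=; auto.
by have [|[->|]] := wo_total x y; auto.
Qed.

Definition add_top := MkWo top_wf top_trans top_total.

End AddTop.

Lemma zhou_class_limit (R : realType) (L : Type) :
  (exists S : LMP R L, separable S /\ exists s t, sim_e S s t /\ ~ sim_s S s t) ->
  (forall (W : woType) (v v' : W), is_pred v' v ->
     forall S : LMP R L, separable S -> ~ zhou_le S v ->
     exists S' : LMP R L, separable S' /\ ~ zhou_le S' v') ->
  exists (W : woType) (w : W), zhou_class_is R L w /\ nonzero_limit w.
Proof.
move=> [S0 [sepS0 [s0 [t0 [e0 ns0]]]]] succ.
have [W0 W0E] := well_order_wo separable_bound.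
pose W := add_top W0.
have card (S : LMP R L) : separable S -> ~ exists f : W -> Rel (lmp_T S), injective f.
  move=> sepS [f fi]; apply: (separable_bound_card sepS); rewrite -W0E.
  by exists (f \o Some) => x y /fi [].
have [|w [ub least]] :=
    @wo_min W (fun w => forall S : LMP R L, separable S -> zhou_le S w).
  (* The added top bounds every stage of [W], so the set of upper bounds is nonempty. *)
  exists None => S sepS; have [u hu] := zhou_exists (card S sepS).
  by exists u; split=> //; case: u hu => [u|] _; [right|left].
have below v : wo_lt v w -> exists S : LMP R L, separable S /\ ~ zhou_le S v.
  move=> /least nv; apply: contrapT => h; apply: nv => S sepS.
  by apply: contrapT => nz; apply: h; exists S.
exists W, w; split=> //; split.
  (* Stage zero is [sim_e], so [S0] shows that zero is not an upper bound. *)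
  apply: contrapT => w0; have : zhou_le S0 w by exact: ub.
  apply/zhou_leNP; exists s0, t0; rewrite Oiter_zero // => v vw.
  by apply: w0; exists v.
move=> v vw; have [v' v'v] := wo_succ vw; exists v'; split; first exact: v'v.1.
have [S [sepS nS]] := below _ vw.
have [S' [sepS' nS']] := succ _ _ _ v'v _ sepS nS.
(* [v' = w] contradicts that [w] is an upper bound; [w] below [v'] contradicts that [v'] is the
   successor of [v]. *)
have [//|[v'w|wv']] := wo_total v' w.
  by case: nS'; rewrite v'w; exact: ub.
have [wv|wv] := v'v.2 _ wv'; first by move: vw; rewrite wv => /wo_lt_irr.
by case: (wo_lt_irr (wo_trans vw wv)).
Qed.

(** * Adding two states to an LMP *)

Definition ext_type (T : Type) : Type := (T + bool)%type.

(** Closed with [Qed], so that the display of the extension is not convertible to the original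
    one. *)
Definition ext_display : measure_display -> measure_display.
Proof. exact. Qed.

Section ExtMeasurable.
Context (d : measure_display) (T : measurableType d).

HB.instance Definition _ := Choice.copy (ext_type T) (T + bool)%type.
HB.instance Definition _ := isPointed.Build (ext_type T) (inl point).

Definition old (x : T) : ext_type T := inl x.
Definition new (b : bool) : ext_type T := inr b.

(** The sum of the given sigma-algebra and the discrete one on the two new points. *)
Definition ext_measurable : set (set (ext_type T)) :=
  [set E | measurable (old @^-1` E)].

Lemma ext_measurable0 : ext_measurable set0.
Proof. by rewrite /ext_measurable /= preimage_set0; exact: measurable0. Qed.

Lemma ext_measurableC E : ext_measurable E -> ext_measurable (~` E).
Proof. by rewrite /ext_measurable /= preimage_setC; exact: measurableC. Qed.

Lemma ext_measurable_bigcup (F : (set (ext_type T))^nat) :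
  (forall i, ext_measurable (F i)) -> ext_measurable (\bigcup_i F i).
Proof.
by rewrite /ext_measurable /= preimage_bigcup; exact: bigcupT_measurable.
Qed.

HB.instance Definition _ := @isMeasurable.Build (ext_display d) (ext_type T)
  ext_measurable ext_measurable0 ext_measurableC ext_measurable_bigcup.

Lemma measurable_extE (E : set (ext_type T)) :
  measurable E = measurable (old @^-1` E).
Proof. by []. Qed.

Lemma old_preimage_image (A : set T) : old @^-1` (old @` A) = A.
Proof. by apply/seteqP; split=> [x [y Ay [<-]]|x Ax] //; exists x. Qed.

Definition ext_gen (G : nat -> set T) (n : nat) : set (ext_type T) :=
  match n with
  | 0 => [set new false]
  | 1 => [set new true]
  | n'.+2 => old @` G n'
  end.

Lemma ext_gen_sigma (G : nat -> set T) :
  @measurable _ T = <<s range G >> ->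
  @measurable _ (ext_type T) = <<s range (ext_gen G) >>.
Proof.
move=> mG; set H := <<s _ >>; have sH : sigma_algebra setT H.
  exact: smallest_sigma_algebra.
have HG n : H (ext_gen G n) by apply: sub_sigma_algebra; exists n.
have HC E : H E -> H (~` E) by move=> HE; rewrite -setTD; case: sH => _ + _; apply.
have HU E F : H E -> H F -> H (E `|` F).
  move=> HE HF; rewrite -bigcup2E; case: sH => H0 _; apply.
  by case=> [|[|n]] //=.
have HN b : H [set new b] by case: b; [exact: (HG 1%N)|exact: (HG 0%N)].
have HT : H (range old).
  have -> : range old = ~` ([set new false] `|` [set new true]).
    apply/seteqP; split=> [_ [x _ <-] []//|[x _|b]]; first by exists x.
    by case=> //; case: b; [right|left].
  by apply: HC; apply: HU.
apply/seteqP; split.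
- move=> E mE.
  have HI (A : set T) : measurable A -> H (old @` A).
    rewrite mG; move: A; apply: smallest_sub => /=; last first.
      by move=> _ [n _ <-]; exact: (HG n.+2).
    split=> [|B HB|F HF] /=; first by rewrite image_set0; case: sH.
    (* The image of a complement is a complement within the old part, whence the need for [HT]. *)
    - have -> : old @` (setT `\` B) = ~` (~` range old `|` old @` B).
        apply/seteqP; split=> [_ [x [_ nB] <-] [[]|[y By [yx]]]|z].
        + by exists x.
        + by apply: nB; rewrite -yx.
        + case: z => [x nz|b []]; last by left=> -[].
          by exists x => //; split=> // Bx; apply: nz; right; exists x.
      by apply: (HC); apply: HU => //; exact: HC.
    - by rewrite image_bigcup; case: sH => _ _; apply.
  have -> : E = old @` (old @^-1` E) `|`
      ((if `[< E (new false) >] then [set new false] else set0) `|`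
       (if `[< E (new true) >] then [set new true] else set0)).
    apply/seteqP; split=> [[x|b] Ez|z [[x Ex <-]//|[]]].
    + by left; exists x.
    + by right; case: b Ez => Eb; [right|left]; case: asboolP.
    + by case: asboolP => // ? ->.
    + by case: asboolP => // ? ->.
  have H0 : H set0 by case: sH.
  apply: (HU); first exact: HI.
  by apply: HU; case: asboolP.
- apply: smallest_sub; first by split=> [|A mA|F mF]; [exact: measurable0
    |rewrite setTD; exact: measurableC|exact: bigcupT_measurable].
  move=> _ [[|[|n]] _ <-]; rewrite measurable_extE /=.
  + by rewrite (_ : _ @^-1` _ = set0) //; apply/seteqP; split.
  + by rewrite (_ : _ @^-1` _ = set0) //; apply/seteqP; split.
  + by rewrite old_preimage_image mG; apply: sub_sigma_algebra; exists n.
Qed.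

End ExtMeasurable.

Section Extension.
Context (R : realType) (L : Type) (S : LMP R L).
Local Notation T := (lmp_T S).
Local Notation tau := (lmp_tau S).
Context (m : bool -> {measure set T -> \bar R}).
Hypothesis m_le1 : forall b, (m b setT <= 1)%E.

(** The new states receive no mass, so old states behave as before. At the new states any choice of
    measures is measurable in the state. *)
Definition ext_tau (a : L) (z : ext_type T) : set (ext_type T) -> \bar R :=
  match z with
  | inl x => pushforward (tau a x) (@old _ T)
  | inr b => pushforward (m b) (@old _ T)
  end.

Lemma ext_tau_measure a z : isMeasure _ _ R (ext_tau a z).
Proof.
have mE (F : set (ext_type T)) : measurable F -> measurable (@old _ T @^-1` F) by [].
have ti F : trivIset setT F -> trivIset setT (fun n : nat => @old _ T @^-1` F n).
  by move=> /trivIsetP tF; apply/trivIsetP => i j _ _ /(tF i j I I) Fij;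
     rewrite -preimage_setI Fij preimage_set0.
by case: z => [x|b] /=; split; rewrite /pushforward ?preimage_set0 ?measure0 //;
  move=> F mF tF mUF; rewrite preimage_bigcup;
  (apply: measure_semi_sigma_additive => [n||];
   [exact: mE|exact: ti|rewrite -preimage_bigcup; exact: mE]).
Qed.

HB.instance Definition _ a z := ext_tau_measure a z.

Definition ext_kernel (a : L) (z : ext_type T) :
  {measure set (ext_type T) -> \bar R} := ext_tau a z.

Lemma measurable_ext_kernel a (U : set (ext_type T)) : measurable U ->
  measurable_fun [set: ext_type T] (ext_kernel a ^~ U).
Proof.
move=> mU _ B mB; rewrite setTI measurable_extE.
by have := measurable_kernel (tau a) _ mU measurableT B mB; rewrite setTI.
Qed.

HB.instance Definition _ a :=
  isKernel.Build _ _ _ _ R (ext_kernel a) (@measurable_ext_kernel a).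

Lemma ext_kernel_le1 a :
  (ereal_sup [set ext_kernel a x [set: ext_type T] | x in [set: ext_type T]] <= 1)%E.
Proof.
apply/sprob_kernelP => -[x|b] /=; rewrite /pushforward preimage_setT //.
have /(sprob_kernelP (fun x => tau a x : set _ -> _)) := @sprob_kernel _ _ _ _ _ (tau a).
by apply.
Qed.

HB.instance Definition _ a :=
  Kernel_isSubProbability.Build _ _ _ _ R (ext_kernel a) (ext_kernel_le1 a).

Definition ext_LMP : LMP R L := @MkLMP R L _ (ext_type T) ext_kernel.

Definition ext_old : T -> lmp_T ext_LMP := @old _ T.
Definition ext_new : bool -> lmp_T ext_LMP := @new _ T.

Lemma ext_tau_old a x E : lmp_tau ext_LMP a (ext_old x) E = tau a x (ext_old @^-1` E).
Proof. by []. Qed.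

Lemma ext_tau_new a b E : lmp_tau ext_LMP a (ext_new b) E = m b (ext_old @^-1` E).
Proof. by []. Qed.

Lemma ext_separable : separable S -> separable ext_LMP.
Proof.
move=> [[G mG] sep]; split; first by exists (ext_gen G); exact: ext_gen_sigma.
have m1 (b : bool) : measurable [set ext_new b].
  by rewrite measurable_extE (_ : _ @^-1` _ = set0) //; apply/seteqP; split.
move=> [x|b] y xy; last by exists [set ext_new b]; split=> //; split=> // /esym.
case: y xy => [y|b] xy; last first.
  by exists (~` [set ext_new b]); split; [exact: measurableC|split=> //; apply].
have [|A [mA [Ax nAy]]] := sep x y; first by move=> e; apply: xy; rewrite e.
exists (ext_old @` A); split; first by rewrite measurable_extE old_preimage_image.
by split; [exists x|move=> [z Az [zy]]; apply: nAy; rewrite -zy].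
Qed.

Lemma ext_den f : ext_old @^-1` (den (S := ext_LMP) f) = den (S := S) f.
Proof.
elim: f => [|f IHf g IHg|a q f IHf] //=; first by rewrite preimage_setI IHf IHg.
by apply/seteqP; split=> x /=; rewrite ext_tau_old IHf.
Qed.

Lemma ext_sim_e s t : sim_e S s t -> sim_e ext_LMP (ext_old s) (ext_old t).
Proof.
move=> st; apply: sim_e_formula => f /(@sim_e_den _ _ S s t).
by rewrite -ext_den; exact.
Qed.

Lemma ext_sim_e_new : (forall f, m false (den f) = m true (den f)) ->
  sim_e ext_LMP (ext_new false) (ext_new true).
Proof.
move=> mm; apply: sim_e_formula; elim=> [|f IHf g IHg|a q f _] //=.
  by move=> [/IHf[? ?] /IHg[? ?]]; split=> -[]; auto.
move=> _; have key b : m b (ext_old @^-1` den f) = m true (den f).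
  by rewrite ext_den; case: b; rewrite ?mm.
by rewrite /pushforward !key.
Qed.

(* A set [C] closed under [sim_s S] is the trace on [S] of its saturation under
   [sim_s ext_LMP], which is measurable because every subset of the new points is. *)
Lemma ext_sim_s_closed Q C : SigmaR Q C ->
  (forall s t, sim_s ext_LMP (ext_old s) (ext_old t) -> Q s t) ->
  exists2 E, SigmaR (sim_s ext_LMP) E & ext_old @^-1` E = C.
Proof.
move=> [mC cC] sQ; pose E := [set z | exists2 c, C c & sim_s ext_LMP (ext_old c) z].
have EC : ext_old @^-1` E = C.
  apply/seteqP; split=> [x [c Cc /sQ]|x Cx]; first exact: cC.
  by exists x => //; apply: Oop_sim_s.
exists E => //; split; first by rewrite measurable_extE EC.
by move=> x y [c Cc cx] xy; exists c => //; exact: sim_s_trans xy.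
Qed.

(** Bisimilarity restricted to the old states is a state bisimulation on [S], as its closed sets are
    traces of closed sets of the extension. *)
Lemma ext_sim_s s t : sim_s ext_LMP (ext_old s) (ext_old t) -> sim_s S s t.
Proof.
move: s t; apply: (@bisim_sub_sim_s _ _ S
    (fun s t => sim_s ext_LMP (ext_old s) (ext_old t))) => [s t|s t st a C SC].
  exact: sim_s_sym.
have [|E SE <-] := ext_sim_s_closed SC; first by [].
by rewrite -!ext_tau_old; exact: sim_s_Oop st a E SE.
Qed.

(** The label is essential: with no labels all states are bisimilar. *)
Lemma ext_sim_s_new (a : L) C : SigmaR (sim_s S) C -> m false C <> m true C ->
  ~ sim_s ext_LMP (ext_new false) (ext_new true).
Proof.
move=> SC mC pq; have [E SE EC] := ext_sim_s_closed SC ext_sim_s.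
by apply: mC; rewrite -EC -!(ext_tau_new a); exact: sim_s_Oop pq a E SE.
Qed.

Section Iterates.
Context (W : woType).
Local Notation I := (Oiter (W := W) (Oop S) (sim_e S)).
Local Notation I' := (Oiter (W := W) (Oop ext_LMP) (sim_e ext_LMP)).

Lemma ext_SigmaR Q (Q' : Rel (lmp_T ext_LMP)) E :
  (forall s t, Q s t -> Q' (ext_old s) (ext_old t)) -> SigmaR Q' E ->
  SigmaR Q (ext_old @^-1` E).
Proof. by move=> QQ' [mE cE]; split=> // x y Ex /QQ'; exact: cE. Qed.

(** Sets closed for the extended iterate restrict to sets closed for the old one, so equality of
    kernel values transfers at successors. *)
Lemma ext_Oiter (w : W) s t : I w s t -> I' w (ext_old s) (ext_old t).
Proof.
move: w s t; apply: (@Oiter_ind _ _ (Oop ext_LMP) (sim_e ext_LMP)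
    (fun w X => forall s t, I w s t -> X (ext_old s) (ext_old t))).
- by move=> w w0 s t; rewrite Oiter_zero //; exact: ext_sim_e.
- move=> w p wp IH s t; rewrite (Oiter_succ _ _ wp) => h a E SE.
  by rewrite !ext_tau_old; apply: h; exact: ext_SigmaR IH SE.
- move=> w ev np IH s t; rewrite Oiter_limit // => h v vw.
  exact: IH (h v vw).
Qed.

Lemma ext_Oiter_new (v v' : W) : is_pred v' v ->
  (forall E, SigmaR (I v) E -> m false E = m true E) ->
  I' v' (ext_new false) (ext_new true).
Proof.
move=> v'v mm; rewrite (Oiter_succ _ _ v'v) => a E SE; rewrite !ext_tau_new.
by apply: mm; apply: ext_SigmaR SE => s t; exact: ext_Oiter.
Qed.

End Iterates.
End Extension.

(** * From an ordinal to its successor *)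

Section Successor.
Context (R : realType) (L : Type).

(** [Rclosed] looks in one direction only; symmetry turns it into an equivalence of memberships. *)
Lemma Oiter_sym (S : LMP R L) (W : woType) (w : W) s t :
  Oiter (Oop S) (sim_e S) w s t -> Oiter (Oop S) (sim_e S) w t s.
Proof.
move: w s t; apply: (@Oiter_ind _ _ (Oop S) (sim_e S)
    (fun w X => forall s t, X s t -> X t s)) => [w _ s t h A|w p _ _ s t h a E|].
- by move=> GA; apply: iff_sym; exact: h.
- by move=> SE; rewrite h.
- by move=> w _ _ IH s t h v vw; apply: IH => //; exact: h.
Qed.

Lemma zhou_succ (a0 : L) (W : woType) (v v' : W) : is_pred v' v ->
  forall S : LMP R L, separable S -> ~ zhou_le S v ->
  exists S' : LMP R L, separable S' /\ ~ zhou_le S' v'.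
Proof.
move=> v'v S sepS /zhou_leNP[s [t [Ist nst]]].
(* These Dirac masses agree on all sets closed under stage [v] and differ on a bisimilarity-closed
   set separating [s] from [t]. *)
pose m (b : bool) : {measure set (lmp_T S) -> \bar R} := \d_(if b then t else s).
have m1 b : (m b setT <= 1)%E by rewrite /m /= diracT.
exists (ext_LMP m1); split; first exact: ext_separable.
apply/zhou_leNP; exists (ext_new m1 false), (ext_new m1 true).
split.
  apply: ext_Oiter_new v'v _ => E [_ cE]; rewrite /m /= !diracE.
  suff -> : (s \in E) = (t \in E) by [].
  by apply/idP/idP; rewrite !inE => /cE; apply=> //; exact: Oiter_sym.
have [C SC nC] := sim_s_separated nst.
refine (ext_sim_s_new a0 SC _); rewrite /m /= !diracE => -[mC]; apply: nC.
suff CE : (s \in C) = (t \in C).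
  by split=> [/mem_set|/mem_set]; [rewrite CE|rewrite -CE] => /set_mem.
by apply/eqP; move/eqP: mC; rewrite eqr_nat; case: (_ \in _) (_ \in _) => [] [].
Qed.

End Successor.

(** * A set not measurable for Lebesgue outer measure *)

Section OuterLebesgue.
Context (R : realType).
Local Notation lam := ((@wlength R idfun)^*)%mu.
Local Open Scope ereal_scope.

Lemma lam_borel (A : set R) : measurable A -> lam A = lebesgue_measure A.
Proof. by []. Qed.

Lemma borel_caratheodory (A : set R) : measurable A -> lam.-caratheodory A.
Proof. exact: sub_caratheodory. Qed.

Lemma le_lam (A B : set R) : A `<=` B -> lam A <= lam B.
Proof. exact: (le_outer_measure lam). Qed.

Lemma lam_hull (A : set R) :
  exists H : set R, [/\ measurable H, A `<=` H & lam H = lam A].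
Proof.
have [G [oG AG lG]] := outer_measure_Gdelta A.
exists (\bigcap_i G i); split=> //.
by apply: bigcapT_measurable => i; exact: open_measurable.
Qed.

Lemma lam_itvcc (a b : R) : (a <= b)%R -> lam `[a, b]%classic = (b - a)%:E.
Proof.
move=> ab; rewrite lam_borel; last exact: measurable_itv.
rewrite lebesgue_measure_itv /= lte_fin; case: ltP => // ba.
by rewrite (@le_anti _ _ a b) ?ab // subrr.
Qed.

Definition shift (q : R) (A : set R) : set R := [set x | A (x - q)%R].

Lemma shiftK q : cancel (shift q) (shift (- q)%R).
Proof. by move=> A; apply/seteqP; split=> x; rewrite /shift /= opprK addrK. Qed.

(** The pushforward under translation agrees with Lebesgue measure on half-open intervals, hence on
    all Borel sets. *)
Lemma lam_shift_borel q (A : set R) : measurable A ->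
  measurable (shift q A) /\ lam (shift q A) = lam A.
Proof.
move=> mA; pose f (x : measurableTypeR R) : measurableTypeR R := (x - q)%R.
have mf : measurable_fun setT f.
  by apply: measurable_funB; [exact: measurable_id|exact: measurable_cst].
have mS : measurable (shift q A) by have := mf measurableT A mA; rewrite setTI.
split=> //; rewrite !lam_borel //.
pose nu : {measure set (measurableTypeR R) -> \bar R} :=
  pushforward (@lebesgue_measure R) f.
rewrite (@lebesgue_measure_unique R (nu mf) _ A mA) // => X [[a b] _ <-] /=.
rewrite /nu /= /pushforward lebesgue_measure_itv /=.
rewrite (_ : f @^-1` _ = `](a + q)%R, (b + q)%R]%classic); last first.
  by apply/seteqP; split=> x; rewrite /f /= !in_itv /= ltrBrDr lerBlDr.
by rewrite lebesgue_measure_itv /= !lte_fin ltrD2r -!EFinB opprD addrACA subrr addr0.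
Qed.

(** Borel hulls give one inequality, and shifting back gives the other. *)
Lemma lam_shift q (A : set R) : lam (shift q A) = lam A.
Proof.
have le q' (B : set R) : lam (shift q' B) <= lam B.
  have [H [mH BH <-]] := lam_hull B.
  have [_ <-] := lam_shift_borel q' mH.
  by apply: le_lam => x; exact: BH.
by apply/eqP; rewrite eq_le le /= -{1}(shiftK q A) le.
Qed.

Lemma shift_caratheodory q (A : set R) :
  lam.-caratheodory A -> lam.-caratheodory (shift q A).
Proof.
move=> cA X; rewrite -(lam_shift (- q) X) cA.
by rewrite -(lam_shift (- q) (X `&` shift q A)) -(lam_shift (- q) (X `&` ~` shift q A));
  congr (lam _ + lam _); apply/seteqP; split=> x; rewrite /shift /= opprK addrK.
Qed.

(** The coset of the rationals through [x], cut down to the unit interval. *)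
Definition rat_class (x : R) : set R :=
  [set y | `[0%R, 1%R]%classic y /\ exists q : rat, (y - x)%R = ratr q].

Definition vitali : set R := range (fun x => xget 0%R (rat_class x)).

Lemma rat_class_xget x : rat_class x (xget 0%R (rat_class x)).
Proof.
(* The fractional part of [x] shows that the class is nonempty. *)
apply: xgetPex; exists (x - (Num.floor x)%:~R)%R; split.
  rewrite /= in_itv /= subr_ge0 floor_le_tmp /= lerBlDr addrC.
  by apply/ltW; rewrite -intrD1 floorD1_gt.
exists (- (Num.floor x)%:~R)%R; rewrite addrAC subrr add0r.
by rewrite rmorphN /= ratr_int.
Qed.

Lemma vitali_sub : vitali `<=` `[0%R, 1%R]%classic.
Proof. by move=> _ [x _ <-]; case: (rat_class_xget x). Qed.

(** Points at rational distance have the same class as a set, so [xget] picks the same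
    representative. *)
Lemma vitali_inj x y q : vitali x -> vitali y -> (x - y)%R = ratr q -> x = y.
Proof.
move=> [u _ <-] [v _ <-] e; congr xget.
have [_ [q1 e1]] := rat_class_xget u; have [_ [q2 e2]] := rat_class_xget v.
have uv : (u - v)%R = ratr (q - q1 + q2).
  rewrite rmorphD rmorphB /= -e -e1 -e2; ring.
apply/seteqP; split=> z [z01 [q3 e3]]; split=> //.
- by exists (q3 + (q - q1 + q2))%R; rewrite rmorphD /= -uv -e3 addrA subrK.
- by exists (q3 - (q - q1 + q2))%R; rewrite rmorphB /= -uv -e3 opprB addrA subrK.
Qed.

(** Countably many rational translates of [vitali] cover the unit interval. *)
Lemma lam_vitali_neq0 : lam vitali <> 0.
Proof.
move=> V0; pose A n := if unpickle n is Some q then shift (ratr q) vitali else set0.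
have cov : `[0%R, 1%R]%classic `<=` \bigcup_n A n.
  move=> x _; have [_ [q e]] := rat_class_xget x.
  exists (pickle (- q)%R); first by [].
  rewrite /A pickleK /shift /=.
  by exists x => //; rewrite rmorphN /= opprK -e addrCA subrr addr0.
have A0 n : lam (A n) = 0.
  rewrite /A; case: unpickle => [q|]; first by rewrite lam_shift.
  exact: outer_measure0.
have : lam `[0%R, 1%R]%classic <= 0.
  apply: (le_trans (le_lam cov)).
  apply: (le_trans (outer_measure_sigma_subadditive lam A)).
  by rewrite eseries0 // => n _ _; exact: A0.
by rewrite lam_itvcc // subr0 lee_fin ler10.
Qed.

(** The translates by [1/(n+1)] are pairwise disjoint and lie in [[0, 2]]; additivity would bound
    every multiple of a positive number by 2. *)
Lemma vitali_not_caratheodory : ~ lam.-caratheodory vitali.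
Proof.
move=> cV; pose A n := shift n.+1%:R^-1 vitali.
have tA : trivIset setT A.
  apply/trivIsetP => i j _ _ ij; apply/seteqP; split=> // x [Vi Vj].
  have e : ((x - i.+1%:R^-1) - (x - j.+1%:R^-1))%R =
      ratr (j.+1%:R^-1 - i.+1%:R^-1)%R :> R.
    by rewrite rmorphB /= !fmorphV /= !ratr_nat opprB addrCA addrAC subrr add0r.
  have := vitali_inj Vi Vj e => /addrI/oppr_inj/invr_inj/eqP.
  by rewrite eqr_nat eqSS (negbTE ij).
have lA n : lam (\big[setU/set0]_(i < n) A i) = lam vitali *+ n.
  have := caratheodory_additive (fun n => shift_caratheodory n.+1%:R^-1 cV) tA n setT.
  rewrite setTI => ->; rewrite (eq_bigr (fun=> lam vitali)); last first.
    by move=> i _; rewrite setTI; exact: lam_shift.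
  rewrite big_const_ord; elim: n => // n IH; rewrite iterS IH.
  by case: n {IH} => [|n] //; rewrite adde0.
have lV1 : lam vitali <= 1.
  by rewrite (le_trans (le_lam vitali_sub)) // lam_itvcc // subr0.
have fV : lam vitali \is a fin_num.
  by rewrite ge0_fin_numE ?outer_measure_ge0 // (le_lt_trans lV1) // ltry.
have l2 n : lam (\big[setU/set0]_(i < n) A i) <= 2%:E.
  have sub : \big[setU/set0]_(i < n) A i `<=` `[0%R, 2%R]%classic.
    rewrite -bigcup_mkord => x [i _ /vitali_sub]; rewrite /= !in_itv /= => /andP[].
    rewrite subr_ge0 => x0 x1; rewrite (le_trans _ x0) /=; last by rewrite invr_ge0.
    move: x1; rewrite lerBlDr => /le_trans; apply.
    by rewrite -[leRHS]/(1 + 1)%R lerD2l invf_le1 // ler1n.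
  by rewrite (le_trans (le_lam sub)) // lam_itvcc // subr0.
apply: lam_vitali_neq0; apply/eqP; rewrite eq_le outer_measure_ge0 andbT.
rewrite -(fineK fV) lee_fin leNgt; apply/negP => V0.
have [n] : exists n, (2 < fine (lam vitali) *+ n)%R.
  exists (Num.truncn (2 / fine (lam vitali))).+1.
  by rewrite -[ltRHS]mulr_natr -ltr_pdivrMl // mulrC truncnS_gt.
have := l2 n; rewrite lA -(fineK fV) -EFin_natmul lee_fin => h.
by rewrite ltNge h.
Qed.

(** Cut [H] and [V] along [B]. The totals are equal and finite, and outside [B] the part of [V] is
    at most that of [H]; so inside [B] it cannot be smaller. *)
Lemma lam_hull_trace (V H B : set R) : measurable H -> V `<=` H ->
  lam H = lam V -> lam V < +oo -> measurable B -> B `<=` H ->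
  lam (B `&` V) = lam B.
Proof.
move=> mH VH HV Voo mB BH; apply/eqP.
rewrite eq_le le_lam; last by move=> x [].
have := HV; rewrite (borel_caratheodory mB H) (borel_caratheodory mB V).
rewrite (setIidr BH) (setIC V B) => e.
have fc : lam (H `&` ~` B) \is a fin_num.
  rewrite ge0_fin_numE ?outer_measure_ge0 // (le_lt_trans _ Voo) // -HV.
  by apply: le_lam => x [].
rewrite -(leeD2rE _ _ fc) e leeD2l //; apply: le_lam => x [Vx nB].
by split=> //; exact: VH.
Qed.

Lemma lam_hullU (V U : set R) : measurable U -> V `<=` U ->
  exists H, [/\ measurable H, V `<=` H, H `<=` U & lam H = lam V].
Proof.
move=> mU VU; have [H [mH VH HV]] := lam_hull V.
exists (H `&` U); split; [exact: measurableI|by rewrite subsetI|by move=> x []|].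
by apply/eqP; rewrite eq_le -{1}HV !le_lam //; rewrite subsetI.
Qed.

(* [D] is the intersection of the measurable hulls of the Vitali set and of its
   complement in the unit interval: both have full outer measure in [D]. *)
Lemma nonmeasurable_split : exists V X0 X1 : set R,
  [/\ X0 `<=` V, X1 `<=` ~` V, lam X0 != 0, lam X0 <= 1 &
     forall B, measurable B -> lam (B `&` X0) = lam (B `&` X1)].
Proof.
pose V := vitali; pose U : set R := `[0%R, 1%R]%classic; pose V' := U `\` V.
have mU : measurable U by exact: measurable_itv.
have lU : lam U = 1 by rewrite lam_itvcc // subr0.
have [H [mH VH HU lH]] := lam_hullU mU vitali_sub.
have V'U : V' `<=` U by move=> x [].
have [H' [mH' VH' HU' lH']] := lam_hullU mU V'U.
have Uoo X : X `<=` U -> lam X < +oo.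
  by move=> /le_lam; rewrite lU => /le_lt_trans; apply; rewrite ltry.
pose D := H `&` H'; have mD : measurable D by exact: measurableI.
have DV B : measurable B -> lam (B `&` (D `&` V)) = lam (B `&` D).
  move=> mB; rewrite setIA (lam_hull_trace mH VH lH) //.
  - exact: Uoo vitali_sub.
  - exact: measurableI.
  - by move=> x [_ []].
have DV' B : measurable B -> lam (B `&` (D `&` V')) = lam (B `&` D).
  move=> mB; rewrite setIA (lam_hull_trace mH' VH' lH') //.
  - exact: Uoo.
  - exact: measurableI.
  - by move=> x [_ []].
exists V, (D `&` V), (D `&` V'); split.
- by move=> x [].
- by move=> x [_ []].
(* If [D] were null, so would be its subset [H \ V], and [V] would be Carathéodory measurable as [H]
   minus a null set. *)
- rewrite -[D `&` V]setTI DV // setTI; apply/eqP => D0.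
  apply: vitali_not_caratheodory.
  have -> : vitali = H `&` ~` (H `\` V).
    apply/seteqP; split=> [x Vx|x [Hx nHV]]; first by split; [exact: VH|case].
    by apply: contrapT => nV; apply: nHV.
  apply: caratheodory_measurable_setI; first exact: borel_caratheodory.
  apply: caratheodory_measurable_setC; apply: le_caratheodory_measurable => X.
  have N0 : lam (X `&` (H `\` V)) = 0.
    apply/eqP; rewrite eq_le outer_measure_ge0 andbT -D0.
    apply: le_lam => x [_ [Hx nV]]; split=> //.
    by apply: VH'; split=> //; exact: HU.
  by rewrite [Y in Y + _]N0 add0e; apply: le_lam => x [].
- rewrite -lU; apply: le_lam => x [_ ]; exact: vitali_sub.
- by move=> B mB; rewrite DV // DV'.
Qed.

End OuterLebesgue.

(** * Event bisimilarity differs from state bisimilarity *)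

Section TraceOuterMeasure.
Context (R : realType) (T : Type) (mu : {outer_measure set T -> \bar R}).
Context (X : set T).
Local Open Scope ereal_scope.

Definition trace_outer (Y : set T) : \bar R := mu (Y `&` X).

Let trace_outer0 : trace_outer set0 = 0.
Proof. by rewrite /trace_outer set0I outer_measure0. Qed.

Let trace_outer_ge0 Y : 0 <= trace_outer Y.
Proof. exact: outer_measure_ge0. Qed.

Let le_trace_outer : {homo trace_outer : A B / A `<=` B >-> A <= B}.
Proof. by move=> A B AB; apply: le_outer_measure; exact: setSI. Qed.

Let trace_outer_sigma_subadditive : sigma_subadditive trace_outer.
Proof.
move=> F; rewrite /trace_outer setI_bigcupl.
exact: (outer_measure_sigma_subadditive mu (fun n => F n `&` X)).
Qed.

HB.instance Definition _ := isOuterMeasure.Build R T trace_outer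
  trace_outer0 trace_outer_ge0 le_trace_outer trace_outer_sigma_subadditive.

Lemma trace_caratheodory A :
  mu.-caratheodory A -> trace_outer.-caratheodory A.
Proof. by move=> cA Y; rewrite /trace_outer (cA (Y `&` X)) !(setIAC _ X). Qed.

(** The trace of any test set on the complement of [V] is empty. *)
Lemma trace_caratheodory_sub V : X `<=` V -> trace_outer.-caratheodory V.
Proof.
move=> XV Y; rewrite /trace_outer.
rewrite -(setIA Y (~` V)) (_ : ~` V `&` X = set0); last first.
  by apply/seteqP; split=> // x [nV /XV].
by rewrite setI0 outer_measure0 adde0 -setIA (setIidr XV).
Qed.

Lemma trace_caratheodory_disj V : X `<=` ~` V -> trace_outer.-caratheodory V.
Proof.
move=> XV; rewrite -(setCK V); apply: caratheodory_measurable_setC.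
exact: trace_caratheodory_sub.
Qed.

End TraceOuterMeasure.

Section GeneratedCaratheodory.
Context (R : realType) (T : pointedType) (nu : {outer_measure set T -> \bar R}).
Context (G : set (set T)).
Hypothesis cG : forall A, G A -> nu.-caratheodory A.

(** The unnamed argument records the hypothesis in the term, so that the measure instance can be
    inferred from it. *)
Definition gen_measure (_ : forall A, G A -> nu.-caratheodory A)
  (A : set (g_sigma_algebraType G)) : \bar R := nu A.

Lemma gen_caratheodory A : <<s G >> A -> nu.-caratheodory A.
Proof.
apply: smallest_sub; last exact: cG.
split; first exact: caratheodory_measurable_set0.
- by move=> B cB; rewrite setTD; exact: caratheodory_measurable_setC.
- by move=> F cF; exact: caratheodory_measurable_bigcup.
Qed.

Let gen_measure0 : gen_measure cG set0 = 0%E.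
Proof. exact: outer_measure0. Qed.

Let gen_measure_ge0 A : (0 <= gen_measure cG A)%E.
Proof. exact: outer_measure_ge0. Qed.

Let gen_measure_sigma_additive : semi_sigma_additive (gen_measure cG).
Proof.
move=> F mF tF mUF.
apply: (@caratheodory_measure_sigma_additive R T nu F) => //.
- by move=> n; exact: gen_caratheodory (mF n).
- exact: gen_caratheodory mUF.
Qed.

HB.instance Definition _ := isMeasure.Build _ _ _ (gen_measure cG)
  gen_measure0 gen_measure_ge0 gen_measure_sigma_additive.

End GeneratedCaratheodory.

(** * An LMP on the reals whose logic sees only Borel sets *)

Section BaseLMP.
Context (R : realType) (V : set R).

Definition base_gen (n : nat) : set R :=
  if n is n'.+1 then
    if unpickle n' is Some q then `]ratr q, +oo[%classic else set0
  else V.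

Local Notation T := (g_sigma_algebraType (range base_gen)).

Lemma borel_base (A : set R) : measurable A -> measurable (A : set T).
Proof.
have sH := smallest_sigma_algebra [set: R] (range base_gen).
move=> mA; have {mA} : <<s @RGenOInfty.G R >> A.
  exact: (eq_ind _ (fun F : set (set R) => F A) mA _ (RGenOInfty.measurableE R)).
move: A; apply: smallest_sub; [exact: sH|move=> _ [x ->]].
(* The rational rays inside []x, +oo[], with empty sets at all other indices. *)
pose F n := if unpickle n is Some q then
  (if (x < ratr q :> R)%R then `]ratr q, +oo[%classic else set0) else set0 : set R.
have -> : `]x, +oo[%classic = \bigcup_n F n.
  apply/seteqP; split=> [y|y [n _]].
    rewrite /= in_itv /= andbT => xy.
    have [q] := rat_in_itvoo xy; rewrite in_itv /= => /andP[xq qy].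
    by exists (pickle q); [by []|rewrite /F pickleK xq /= in_itv /= andbT].
  rewrite /F; case: unpickle => // q; case: ifP => // xq.
  by rewrite /= !in_itv /= !andbT; exact: lt_trans.
have [H0 _ HU] := sH; apply: HU => n; rewrite /F; case E : unpickle => [q|//].
case: ifP => // _; apply: sub_sigma_algebra; exists n.+1 => //=.
by rewrite E.
Qed.

(** The logistic function at [-x]; its injectivity lets the total mass identify the state. *)
Definition sigmoid (x : R) : R := (1 + expR x)^-1.

Lemma sigmoid_inj : injective sigmoid.
Proof. by move=> x y /invr_inj/addrI/expR_inj. Qed.

Lemma sigmoid_ge0 x : 0 <= sigmoid x.
Proof. by rewrite invr_ge0 addr_ge0 // expR_ge0. Qed.

Lemma sigmoid_le1 x : sigmoid x <= 1.
Proof.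
by rewrite invf_le1 ?lerDl ?expR_ge0 // ltr_pwDl // expR_ge0.
Qed.

Lemma measurable_sigmoid : measurable_fun setT sigmoid.
Proof.
apply: continuous_measurable_fun => x; apply: cvgV.
  by rewrite gt_eqF // ltr_pwDl // expR_ge0.
by apply: cvgD; [exact: cvg_cst|exact: continuous_expR].
Qed.

Lemma measurable_sigmoid_scale (c : \bar R) :
  measurable_fun [set: R] (fun x => (sigmoid x)%:E * c)%E.
Proof.
apply: emeasurable_funM; last exact: measurable_cst.
by apply/measurable_EFinP; exact: measurable_sigmoid.
Qed.

(** All states jump to the same point, so the target set enters only as a constant factor and the
    dependence on [x] is Borel even for a non-Borel target. *)
Definition base_kernel (x : T) : {measure set T -> \bar R} :=
  mscale (NngNum (sigmoid_ge0 x)) \d_(point : T).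

Lemma base_kernelE x U : base_kernel x U = ((sigmoid x)%:E * \d_(point : T) U)%E.
Proof. by []. Qed.

Lemma measurable_base_kernel U : measurable U ->
  measurable_fun [set: T] (base_kernel ^~ U).
Proof.
move=> mU _ B mB; rewrite setTI; apply: borel_base.
have := @measurable_sigmoid_scale (\d_(point : T) U) measurableT B mB.
by rewrite setTI.
Qed.

HB.instance Definition _ :=
  isKernel.Build _ _ _ _ R base_kernel measurable_base_kernel.

Lemma base_kernel_le1 : (ereal_sup [set base_kernel x [set: T] | x in [set: T]] <= 1)%E.
Proof.
apply/(sprob_kernelP (fun x => base_kernel x : set _ -> _)) => x.
by rewrite base_kernelE diracT mule1 lee_fin sigmoid_le1.
Qed.

HB.instance Definition _ :=
  Kernel_isSubProbability.Build _ _ _ _ R base_kernel base_kernel_le1.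

Context (L : Type).

Definition base_LMP : LMP R L := @MkLMP R L _ T (fun=> base_kernel).

Lemma base_separable : separable base_LMP.
Proof.
split; first by exists base_gen.
move=> x y xy; exists [set x]; split; last by split=> // /esym.
exact: borel_base (measurable_set1 (x : R)).
Qed.

Lemma base_den_borel f : measurable (den (S := base_LMP) f : set R).
Proof.
elim: f => [|f IHf g IHg|a q f _] /=; first exact: measurableT.
  exact: measurableI.
rewrite -[X in measurable X]setTI; apply: emeasurable_fun_o_infty => //.
exact: measurable_sigmoid_scale.
Qed.

(** The whole space is closed, so bisimilar states have equal total mass. *)
Lemma base_sim_s (a : L) x y : sim_s base_LMP x y -> x = y.
Proof.
move=> /sim_s_Oop /(_ a setT) h; apply: sigmoid_inj.
have : base_kernel x setT = base_kernel y setT by apply: h; split.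
by rewrite !base_kernelE diracT !mule1 => -[].
Qed.

Lemma base_SigmaR (a : L) : SigmaR (sim_s base_LMP) V.
Proof.
split; first by apply: sub_sigma_algebra; exists 0%N.
by move=> x y Vx /(base_sim_s a) <-.
Qed.

End BaseLMP.

Lemma sim_e_neq_sim_s (R : realType) (L : Type) (a0 : L) :
  exists S : LMP R L, separable S /\ exists s t, sim_e S s t /\ ~ sim_s S s t.
Proof.
have [V [X0 [X1 [X0V X1V l0 l1 X01]]]] := nonmeasurable_split R.
pose X b := if b then X1 else X0.
pose lam : {outer_measure set (ocitv_type R) -> \bar R} := ((@wlength R idfun)^*)%mu.
pose nu b := trace_outer lam (X b).
(* [V] contains [X0] and misses [X1], and the other generators are Borel. *)
have cG b A : range (base_gen V) A -> (nu b).-caratheodory A.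
  move=> [[|n] _ <-] /=.
    by case: b; [exact: trace_caratheodory_disj|exact: trace_caratheodory_sub].
  apply: trace_caratheodory; apply: borel_caratheodory.
  by case: unpickle => [q|]; [exact: measurable_itv|exact: measurable0].
pose m b : {measure set (lmp_T (base_LMP V L)) -> \bar R} := gen_measure (cG b).
have m1 b : (m b setT <= 1)%E.
  rewrite /m /= /gen_measure /nu /trace_outer; case: b => /=.
    by rewrite -X01 // setTI.
  by rewrite setTI.
exists (ext_LMP m1); split; first exact: ext_separable (base_separable V L).
exists (ext_new m1 false), (ext_new m1 true); split.
  by apply: ext_sim_e_new => f; exact: X01 (base_den_borel V f).
refine (ext_sim_s_new a0 (base_SigmaR V a0) _).
(* [X0] puts all its nonzero mass on [V], and [X1] puts none there. *)
rewrite /m /= /gen_measure /nu /trace_outer /= (setIidr X0V) => e.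
move/eqP: l0; apply; rewrite e (_ : V `&` X1 = set0) ?outer_measure0 //.
by apply/seteqP; split=> // x [Vx /X1V].
Qed.

Theorem theorem4p7 (R : realType) (L : countType) (a0 : L) :
  exists (W : woType) (w : W), zhou_class_is R L w /\ nonzero_limit w.
Proof.
apply: zhou_class_limit; first exact: sim_e_neq_sim_s a0.
by move=> W v v'; exact: zhou_succ a0 W v v'.
Qed.
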